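(* Let $L$ be a finite-dimensional Lie algebra over a field $\mathbb{F}$ of arbitrary characteristic, and let $S$ be a finite-dimensional irreducible $L$-module with centralizer algebra $\mathbb{D}:=\operatorname{End}_L(S)$. Then $$[L:S]_{\rm split}=\dim_{\mathbb{D}} H^1(L,S)-\dim_{\mathbb{D}} H^1(L/\operatorname{Ann}_L(S),S).$$ In particular, $[L:S]_{\rm split}$ is independent of the choice of the chief series of $L$.
   Context: $H^n(L,M)$ denotes the ordinary (Chevalley–Eilenberg) cohomology of a Lie algebra $L$ with coefficients in an $L$-module $M$. $\operatorname{Ann}_L(S):=\{x\in L\mid x\cdot s=0 \text{ for all } s\in S\}$, and $S$ is regarded as an $L/\operatorname{Ann}_L(S)$-module in the natural way. $\operatorname{End}_L(S)$ is a division algebra, and the cohomology spaces with coefficients in $S$ are vector spaces over it via its action on $S$. A chief series of a finite-dimensional Lie algebra $L$ is an ascending chain $0=L_0\subset L_1\subset\cdots\subset L_n=L$ of ideals of $L$ such that $L_j/L_{j-1}$ is a minimal (non-zero) ideal of $L/L_{j-1}$ for every $1\le j\le n$; each $L_j/L_{j-1}$ is called a chief factor, and it is an $L$-module via the adjoint action. It is called an abelian chief factor if it is an abelian Lie algebra. For a finite-dimensional irreducible $L$-module $S$ and a given chief series of $L$, $[L:S]_{\rm split}$ denotes the number of indices $j$ such that $L_j/L_{j-1}$ is an abelian chief factor isomorphic to $S$ as an $L$-module and the exact sequence $0\to L_j/L_{j-1}\to L/L_{j-1}\to L/L_j\to 0$ splits in the category of Lie algebras. In the claim, $[L:S]_{\rm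 split}$ is taken with respect to an arbitrary given chief series of $L$. *)

(* Defs.v *)
From HB Require Import structures.
From mathcomp Require Import all_boot all_order all_algebra.
From mathcomp Require Import boolp.

Set Implicit Arguments.
Unset Strict Implicit.
Unset Printing Implicit Defensive.

Import GRing.Theory.
Import VectorInternalTheory.
Local Open Scope ring_scope.
Local Open Scope quotient_scope.

(* A [vectType] is finite-dimensional, possibly zero. The bracket is
   alternating rather than merely antisymmetric, as characteristic 2 is
   allowed. *)
HB.mixin Record isLieAlgebra (F : fieldType) L of Vector F L := {
  lie : L -> L -> L;
  lie_linear_l : forall y, linear (lie^~ y);
  lie_linear_r : forall x, linear (lie x);
  liexx : forall x, lie x x = 0;
  jacobi : forall x y z,
    lie x (lie y z) + lie y (lie z x) + lie z (lie x y) = 0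
}.

#[short(type="lieAlgType")]
HB.structure Definition LieAlgebra (F : fieldType) :=
  {L of Vector F L & isLieAlgebra F L}.

Definition lie_hom (F : fieldType) (L K : lieAlgType F) (f : 'Hom(L, K)) :=
  forall x y, f (lie x y) = lie (f x) (f y).

Definition is_ideal (F : fieldType) (L : lieAlgType F) (V : {vspace L}) :=
  forall x y, y \in V -> lie x y \in V.

Record ideal (F : fieldType) (L : lieAlgType F) := Ideal {
  ideal_space :> {vspace L};
  idealP : is_ideal ideal_space
}.

Definition minimal_ideal (F : fieldType) (L : lieAlgType F) (V : {vspace L}) :=
  [/\ is_ideal V, V <> 0%VS
    & forall W : {vspace L},
        is_ideal W -> (W <= V)%VS -> W <> 0%VS -> W = V].

Section LieTheory.
Context {F : fieldType} {L : lieAlgType F}.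
Implicit Types x y z : L.

HB.instance Definition _ x :=
  GRing.isLinear.Build F L L _ (lie x) (lie_linear_r x).

Lemma lieDl x y z : lie (x + y) z = lie x z + lie y z.
Proof. by have := lie_linear_l z 1 x y; rewrite !scale1r. Qed.

Lemma lieZl (a : F) x z : lie (a *: x) z = a *: lie x z.
Proof.
have l0 : lie 0 z = 0.
  by have /eqP := lieDl 0 0 z; rewrite addr0 -subr_eq0 opprD addNKr oppr_eq0 => /eqP.
by have := lie_linear_l z a x 0; rewrite l0 !addr0.
Qed.

Lemma lie_anti x y : lie x y = - lie y x.
Proof.
apply/eqP; rewrite -addr_eq0; apply/eqP.
by have := liexx (x + y); rewrite linearD /= !lieDl !liexx add0r addr0 addrC.
Qed.

Lemma lie_leibniz x y z : lie (lie x y) z = lie x (lie y z) - lie y (lie x z).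
Proof.
have /eqP := jacobi x y z.
rewrite addr_eq0 [lie z (lie x y)]lie_anti opprK => /eqP <-.
by rewrite [lie z x]lie_anti linearN.
Qed.

End LieTheory.

Section VectorQuotient.
Context {F : fieldType} {V : vectType F}.
Variable U : {vspace V}.

Definition vquot : Type :=
  Quotient.quot (GRing.ZmodClosed.clone V (pred_of_vspace U) _).
HB.instance Definition _ := GRing.Zmodule.on vquot.
HB.instance Definition _ := EqQuotient.on vquot.

Definition vpi (v : V) : vquot := \pi v.

Lemma vpi_eqP v w : reflect (vpi v = vpi w) (v - w \in U).
Proof. by rewrite /vpi Quotient.idealrBE; apply: eqP. Qed.

Lemma vpiD v w : vpi (v + w) = vpi v + vpi w.
Proof. by rewrite /vpi !piE. Qed.

Lemma vreprK (q : vquot) : vpi (repr q) = q.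
Proof. exact: reprK. Qed.

Definition vqscale (a : F) (q : vquot) : vquot := vpi (a *: repr q).

Lemma vqscaleE a v : vqscale a (vpi v) = vpi (a *: v).
Proof. by apply/vpi_eqP; rewrite -scalerBr memvZ //; apply/vpi_eqP/vreprK. Qed.

Fact vqscaleA a b q : vqscale a (vqscale b q) = vqscale (a * b) q.
Proof. by rewrite -[q]vreprK !vqscaleE scalerA. Qed.
Fact vqscale1 : left_id 1 vqscale.
Proof. by move=> q; rewrite -[q]vreprK vqscaleE scale1r. Qed.
Fact vqscaleDr : right_distributive vqscale +%R.
Proof.
by move=> a q r; rewrite -[q]vreprK -[r]vreprK -vpiD !vqscaleE scalerDr vpiD.
Qed.
Fact vqscaleDl q : {morph vqscale^~ q : a b / a + b}.
Proof. by move=> a b; rewrite -[q]vreprK !vqscaleE scalerDl vpiD. Qed.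

HB.instance Definition _ := GRing.Zmodule_isLmodule.Build F vquot
  vqscaleA vqscale1 vqscaleDr vqscaleDl.

Fact vpi_is_linear : linear vpi.
Proof. by move=> a v w; rewrite vpiD -vqscaleE. Qed.
HB.instance Definition _ := GRing.isLinear.Build F V vquot _ vpi vpi_is_linear.

Fact vquot_vect_iso : Vector.axiom (dim (subvs_of (U^C)%VS)) vquot.
Proof.
pose p (v : V) := v - projv U v.
have pU v : v \in U -> p v = 0 by move=> Uv; rewrite /p projv_id ?subrr.
have p_lin : linear p.
  by move=> a v w; rewrite /p linearP scalerBr opprD addrACA.
have p_eq v w : vpi v = vpi w -> p v = p w.
  move=> /vpi_eqP /pU; rewrite addrC -scaleN1r p_lin scaleN1r addrC => /eqP.
  by rewrite subr_eq0 => /eqP.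
have p_repr v : p (repr (vpi v)) = p v by apply/p_eq/vreprK.
pose f (q : vquot) : subvs_of (U^C)%VS := Subvs (memv_projC U (repr q)).
have f_lin : linear f.
  move=> a q r; apply: val_inj; rewrite /= -!/(p _) -p_lin; apply: p_eq.
  by rewrite vreprK [RHS]linearP /= !vreprK.
exists (v2r \o f); first by move=> a q r; rewrite /= f_lin linearP.
exists (fun r => vpi (vsval (r2v r))).
  move=> q; rewrite /= v2rK /= -[RHS]vreprK; apply/vpi_eqP.
  by rewrite addrAC subrr add0r memvN memv_proj.
move=> r; rewrite /= -[RHS]r2vK; congr v2r; apply: val_inj.
rewrite /= -/(p _) p_repr /p.
have : vsval (r2v r) \in lker (projv U) by rewrite lker_proj subvsP.
by rewrite memv_ker => /eqP ->; rewrite subr0.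
Qed.

HB.instance Definition _ := Lmodule_hasFinDim.Build F vquot vquot_vect_iso.

End VectorQuotient.

Section LieQuotient.
Context {F : fieldType} {L : lieAlgType F}.
Variable I : ideal L.

Definition lquot : Type := vquot I.
HB.instance Definition _ := Vector.on lquot.

Definition lpi : 'Hom(L, lquot) := linfun (@vpi F L I).

Definition qlie (q r : lquot) : lquot := lpi (lie (repr q) (repr r)).

Lemma lpi_eqP x y : reflect (lpi x = lpi y) (x - y \in I).
Proof. by rewrite !lfunE; apply: vpi_eqP. Qed.

Lemma lreprK (q : lquot) : lpi (repr q) = q.
Proof. by rewrite lfunE; apply: vreprK. Qed.

Lemma qlieE x y : qlie (lpi x) (lpi y) = lpi (lie x y).
Proof.
set x' := repr (lpi x); set y' := repr (lpi y).
have Ix : x' - x \in I by apply/lpi_eqP/lreprK.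
have Iy : y' - y \in I by apply/lpi_eqP/lreprK.
apply/lpi_eqP; rewrite -/x' -/y'.
have -> : lie x' y' - lie x y = lie x' (y' - y) - lie y (x' - x).
  rewrite !linearB /= [lie y x']lie_anti [lie y x]lie_anti.
  by rewrite !opprK addrA subrK.
by apply: memvB; apply: idealP.
Qed.

Fact qlie_linear_l r : linear (qlie^~ r).
Proof.
move=> a p q; rewrite -[p]lreprK -[q]lreprK -[r]lreprK -linearP !qlieE.
by rewrite lieDl lieZl linearP.
Qed.
Fact qlie_linear_r p : linear (qlie p).
Proof.
move=> a q r; rewrite -[p]lreprK -[q]lreprK -[r]lreprK -linearP !qlieE.
by rewrite !linearP.
Qed.
Fact qliexx q : qlie q q = 0.
Proof. by rewrite -[q]lreprK qlieE liexx linear0. Qed.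
Fact qjacobi p q r :
  qlie p (qlie q r) + qlie q (qlie r p) + qlie r (qlie p q) = 0.
Proof.
rewrite -[p]lreprK -[q]lreprK -[r]lreprK !qlieE -!linearD /= jacobi.
exact: linear0.
Qed.

HB.instance Definition _ := isLieAlgebra.Build F lquot
  qlie_linear_l qlie_linear_r qliexx qjacobi.

Lemma lpi_lie_hom : lie_hom lpi.
Proof. by move=> x y; rewrite -qlieE. Qed.

End LieQuotient.

Arguments lpi {F L} I.

Lemma linfun_linearE (F : fieldType) (V W : vectType F) (f : V -> W) :
  linear f -> linfun f =1 f.
Proof.
move=> f_lin; pose fM := GRing.isLinear.Build F V W _ f f_lin.
pose g : {linear V -> W} := HB.pack f fM.
exact: (lfunE g).
Qed.

Section Bilinear.
Context {F : fieldType} {U V W : vectType F}.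

Definition bilfun (f : U -> V -> W) : 'Hom(U, 'Hom(V, W)) :=
  linfun (fun u => linfun (f u)).

Lemma bilfunE (f : U -> V -> W) :
  (forall v, linear (f^~ v)) -> (forall u, linear (f u)) ->
  forall u v, bilfun f u v = f u v.
Proof.
move=> fl fr u v; rewrite /bilfun linfun_linearE ?linfun_linearE //.
move=> a u1 u2; apply/lfunP => w.
by rewrite !lfun_simp !linfun_linearE //; apply: fl.
Qed.

End Bilinear.

Record lieModType (F : fieldType) (L : lieAlgType F) := LieMod {
  lieMod_sort :> vectType F;
  rho : 'Hom(L, 'End(lieMod_sort));
  rhoP : forall x y m, rho (lie x y) m = rho x (rho y m) - rho y (rho x m)
}.
Arguments rho {F L l}.

Section Modules.
Context {F : fieldType} {L : lieAlgType F}.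
Implicit Types M N : lieModType L.

Lemma rho_linear_l M (m : M) : linear (fun x : L => rho x m).
Proof. by move=> a x y; rewrite linearP !lfun_simp. Qed.

Definition irreducible M :=
  (fullv : {vspace M}) <> 0%VS /\
  forall W : {vspace M},
    (forall x m, m \in W -> rho x m \in W) -> W = 0%VS \/ W = fullv.

Definition mod_iso M N :=
  exists2 f : 'Hom(M, N), bijective f & forall x m, f (rho x m) = rho x (f m).

End Modules.

Section Centralizer.
Context {F : fieldType} {L : lieAlgType F}.
Variable M : lieModType L.

Definition commutator (x : L) (f : 'End(M)) : 'End(M) :=
  (f \o rho x)%VF - (rho x \o f)%VF.

Fact commutator_linear_l f : linear (commutator^~ f).
Proof.
move=> a x y; apply/lfunP => m; rewrite /commutator !lfun_simp !linearP /=.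
by rewrite !lfun_simp linearP /= scalerBr opprD addrACA.
Qed.
Fact commutator_linear_r x : linear (commutator x).
Proof.
move=> a f g; apply/lfunP => m; rewrite /commutator !lfun_simp linearP /=.
by rewrite scalerBr opprD addrACA.
Qed.

Definition endL_space : {vspace 'End(M)} :=
  lker (linfun (fun f => linfun (commutator^~ f))).

Lemma endL_spaceP (f : 'End(M)) :
  reflect (forall x m, f (rho x m) = rho x (f m)) (f \in endL_space).
Proof.
have E g x : linfun (fun f => linfun (commutator^~ f)) g x = commutator x g.
  exact: (@bilfunE _ _ _ _ (fun f x => commutator x f)
           commutator_linear_r commutator_linear_l).
rewrite memv_ker; apply: (iffP eqP) => [f0 x m | fC].
  have := E f x; rewrite f0 lfun_simp => /lfunP /(_ m) /esym.
  by rewrite /commutator !lfun_simp => /eqP; rewrite subr_eq0 => /eqP.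
apply/lfunP => x; rewrite E; apply/lfunP => m.
by rewrite /commutator !lfun_simp fC subrr.
Qed.

(* The ring End_L(M) under composition, (f * g) m = f (g m). *)
Definition endL : Type := subvs_of endL_space.
HB.instance Definition _ := Vector.on endL.

Lemma endLP (f : endL) x m : vsval f (rho x m) = rho x (vsval f m).
Proof. by move: x m; apply/endL_spaceP/subvsP. Qed.

Fact endL_one_subproof : \1%VF \in endL_space.
Proof. by apply/endL_spaceP => x m; rewrite !lfun_simp. Qed.
Fact endL_mul_subproof (f g : endL) : (vsval f \o vsval g)%VF \in endL_space.
Proof. by apply/endL_spaceP => x m; rewrite !lfun_simp /= !endLP. Qed.

Definition endL_one : endL := Subvs endL_one_subproof.
Definition endL_mul (f g : endL) : endL := Subvs (endL_mul_subproof f g).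

Fact endL_mulA : associative endL_mul.
Proof. by move=> f g h; apply/val_inj/comp_lfunA. Qed.
Fact endL_mul1l : left_id endL_one endL_mul.
Proof. by move=> f; apply/val_inj/comp_lfun1l. Qed.
Fact endL_mul1r : right_id endL_one endL_mul.
Proof. by move=> f; apply/val_inj/comp_lfun1r. Qed.
Fact endL_mulDl : left_distributive endL_mul +%R.
Proof. by move=> f g h; apply/val_inj/comp_lfunDl. Qed.
Fact endL_mulDr : right_distributive endL_mul +%R.
Proof. by move=> f g h; apply/val_inj/comp_lfunDr. Qed.

HB.instance Definition _ := GRing.Zmodule_isPzRing.Build endL
  endL_mulA endL_mul1l endL_mul1r endL_mulDl endL_mulDr.

End Centralizer.

Section Cohomology.
Context {F : fieldType} {L : lieAlgType F}.
Variable M : lieModType L.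

(* The Chevalley-Eilenberg differentials out of C^0 = M and C^1 = Hom(L, M),
   with C^2 embedded in the bilinear maps. *)
Definition ce_d0 : 'Hom(M, 'Hom(L, M)) := bilfun (fun m x => rho x m).

Definition ce_d1_fun (f : 'Hom(L, M)) (x y : L) : M :=
  rho x (f y) - rho y (f x) - f (lie x y).

Definition ce_d1 : 'Hom('Hom(L, M), 'Hom(L, 'Hom(L, M))) :=
  linfun (fun f => bilfun (ce_d1_fun f)).

Lemma ce_d0E m x : ce_d0 m x = rho x m.
Proof.
rewrite /ce_d0 bilfunE // => [y | n] a u v; first exact: linearP.
by rewrite linearP !lfun_simp.
Qed.

Lemma ce_d1E f x y : ce_d1 f x y = rho x (f y) - rho y (f x) - f (lie x y).
Proof.
have bE g : forall u v, bilfun (ce_d1_fun g) u v = ce_d1_fun g u v.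
  apply: bilfunE => [v | u] a u1 u2; rewrite /ce_d1_fun.
    rewrite lieDl lieZl !rho_linear_l !linearP /=.
    by rewrite !scalerDr [RHS]addrACA; congr (_ + _); rewrite addrACA.
  rewrite rho_linear_l !linearP /=.
  by rewrite !scalerDr [RHS]addrACA; congr (_ + _); rewrite addrACA.
rewrite /ce_d1 linfun_linearE ?bE // => a g h.
apply/lfunP => u; apply/lfunP => v; rewrite !lfun_simp !bE /ce_d1_fun.
rewrite !lfun_simp !linearP /= !scalerDr !scalerN.
by rewrite [RHS]addrACA; congr (_ + _); rewrite addrACA.
Qed.

Lemma ce_d1_d0 m : ce_d1 (ce_d0 m) = 0.
Proof.
apply/lfunP => x; apply/lfunP => y; rewrite ce_d1E !ce_d0E rhoP !lfun_simp.
by rewrite subrr.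
Qed.

Definition Z1 : {vspace 'Hom(L, M)} := lker ce_d1.
Definition B1 : {vspace 'Hom(L, M)} := limg ce_d0.

Lemma B1_sub_Z1 : (B1 <= Z1)%VS.
Proof. by apply/subvP => _ /memv_imgP[m _ ->]; rewrite memv_ker ce_d1_d0. Qed.

(* Z1 / B1, with B1 pulled back to a subspace of the space Z1. *)
Definition H1 : Type := vquot (linfun (@vsval _ _ Z1) @^-1: B1)%VS.
HB.instance Definition _ := GRing.Zmodule.on H1.

Definition H1_class (z : subvs_of Z1) : H1 := vpi _ z.

(* End_L(M) acts on H1 through its action on the values of cocycles. *)
Fact Z1_comp_subproof (c : endL M) (z : subvs_of Z1) :
  (vsval c \o vsval z)%VF \in Z1.
Proof.
rewrite memv_ker; apply/eqP/lfunP => x; apply/lfunP => y.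
rewrite ce_d1E !lfun_simp /= -!endLP -!linearB /=.
have /eqP/lfunP/(_ x)/lfunP/(_ y) : ce_d1 (vsval z) == 0.
  by rewrite -memv_ker subvsP.
by rewrite ce_d1E !lfun_simp => ->; rewrite linear0.
Qed.

Definition Z1_comp c z : subvs_of Z1 := Subvs (Z1_comp_subproof c z).

Definition H1_scale (c : endL M) (h : H1) : H1 := H1_class (Z1_comp c (repr h)).

Lemma H1_eqP z w :
  reflect (H1_class z = H1_class w) (vsval z - vsval w \in B1).
Proof.
have -> : (vsval z - vsval w \in B1)
    = (z - w \in (linfun (@vsval _ _ Z1) @^-1: B1)%VS).
  by rewrite -memv_preim lfunE.
exact: vpi_eqP.
Qed.

Lemma H1_reprK h : H1_class (repr h) = h.
Proof. exact: vreprK. Qed.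

Lemma H1_classD z w : H1_class (z + w) = H1_class z + H1_class w.
Proof. exact: vpiD. Qed.

Lemma H1_scaleE c z : H1_scale c (H1_class z) = H1_class (Z1_comp c z).
Proof.
apply/H1_eqP; rewrite /= -comp_lfunNr -comp_lfunDr.
have /H1_eqP/memv_imgP[m _ ->] := H1_reprK (H1_class z).
have -> : (vsval c \o ce_d0 m)%VF = ce_d0 (vsval c m).
  by apply/lfunP => x; rewrite !lfun_simp /= !ce_d0E endLP.
exact/memv_img/memvf.
Qed.

Fact H1_scaleA c e h : H1_scale c (H1_scale e h) = H1_scale (c * e) h.
Proof.
rewrite -[h]H1_reprK !H1_scaleE; congr H1_class.
exact/val_inj/comp_lfunA.
Qed.
Fact H1_scale1 : left_id 1 H1_scale.
Proof.
by move=> h; rewrite -[h]H1_reprK H1_scaleE; congr H1_class; apply/val_inj/comp_lfun1l.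
Qed.
Fact H1_scaleDr : right_distributive H1_scale +%R.
Proof.
move=> c h k; rewrite -[h]H1_reprK -[k]H1_reprK -H1_classD !H1_scaleE.
by rewrite -H1_classD; congr H1_class; apply/val_inj/comp_lfunDr.
Qed.
Fact H1_scaleDl h : {morph H1_scale^~ h : c e / c + e}.
Proof.
move=> c e; rewrite -[h]H1_reprK !H1_scaleE -H1_classD; congr H1_class.
exact/val_inj/comp_lfunDl.
Qed.

HB.instance Definition _ := GRing.Zmodule_isLmodule.Build (endL M) H1
  H1_scaleA H1_scale1 H1_scaleDr H1_scaleDl.

End Cohomology.

(* [V] has an [R]-basis of [n] elements; [R] need not be commutative, as for
   the division algebra [endL S]. *)
Definition has_dim (R : pzRingType) (V : lmodType R) (n : nat) :=
  exists b : 'I_n -> V,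
    forall v, exists! c : {ffun 'I_n -> R}, v = \sum_i c i *: b i.
Arguments has_dim R V n : clear implicits.

Definition restr_scalars (R R' : pzRingType) (phi : {rmorphism R -> R'})
  (V : lmodType R') : Type := V.

Section RestrictScalars.
Variables (R R' : pzRingType) (phi : {rmorphism R -> R'}) (V : lmodType R').
Local Notation W := (restr_scalars phi V).

HB.instance Definition _ := GRing.Zmodule.copy W V.

Definition restr_scale (a : R) (v : W) : W :=
  phi a *: (v : V).

Fact restr_scaleA a b v :
  restr_scale a (restr_scale b v) = restr_scale (a * b) v.
Proof. by rewrite /restr_scale rmorphM; apply: scalerA. Qed.
Fact restr_scale1 : left_id 1 restr_scale.
Proof. by move=> v; rewrite /restr_scale rmorph1; apply: scale1r. Qed.
Fact restr_scaleDr : right_distributive restr_scale +%R.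
Proof. by move=> a v w; apply: scalerDr. Qed.
Fact restr_scaleDl v : {morph restr_scale^~ v : a b / a + b}.
Proof. by move=> a b; rewrite /restr_scale rmorphD; apply: scalerDl. Qed.

HB.instance Definition _ := GRing.Zmodule_isLmodule.Build R W
  restr_scaleA restr_scale1 restr_scaleDr restr_scaleDl.

End RestrictScalars.

Section Annihilator.
Context {F : fieldType} {L : lieAlgType F}.
Variable S : lieModType L.

Definition Ann_space : {vspace L} := lker (rho : 'Hom(L, 'End(S))).

Lemma Ann_spaceP x : reflect (forall s : S, rho x s = 0) (x \in Ann_space).
Proof.
rewrite memv_ker; apply: (iffP eqP) => [-> s | x0]; first by rewrite lfun_simp.
by apply/lfunP => s; rewrite x0 lfun_simp.
Qed.

Fact Ann_is_ideal : is_ideal Ann_space.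
Proof.
move=> x y /Ann_spaceP y0; apply/Ann_spaceP => s.
by rewrite rhoP !y0 linear0 subrr.
Qed.

Definition Ann : ideal L := Ideal Ann_is_ideal.

Definition rho_Ann : 'Hom(lquot Ann, 'End(S)) :=
  linfun (fun q : lquot Ann => rho (repr q) : 'End(S)).

Lemma rho_AnnE x : rho_Ann (lpi Ann x) = rho x.
Proof.
have E y : rho (repr (lpi Ann y)) = rho y :> 'End(S).
  apply/eqP; rewrite -subr_eq0 -linearB -memv_ker.
  exact/(@lpi_eqP _ _ Ann)/lreprK.
rewrite /rho_Ann linfun_linearE ?E // => a p q.
by rewrite -[p in LHS]lreprK -[q in LHS]lreprK -linearP E linearP.
Qed.

Fact rho_AnnP x y s :
  rho_Ann (lie x y) s = rho_Ann x (rho_Ann y s) - rho_Ann y (rho_Ann x s).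
Proof.
by rewrite -[x]lreprK -[y]lreprK -lpi_lie_hom !rho_AnnE rhoP.
Qed.

Definition mod_Ann : lieModType (lquot Ann) := LieMod rho_AnnP.

(* End_L(S) -> End_{L/Ann}(S), the identity on underlying maps. *)
Fact endL_Ann_subproof (c : endL S) : vsval c \in endL_space mod_Ann.
Proof.
by apply/endL_spaceP => q s; rewrite -[q]lreprK /= rho_AnnE endLP.
Qed.

Definition endL_Ann (c : endL S) : endL mod_Ann := Subvs (endL_Ann_subproof c).

Fact endL_Ann_zmod : zmod_morphism endL_Ann.
Proof. by move=> c e; apply: val_inj. Qed.
Fact endL_Ann_monoid : monoid_morphism endL_Ann.
Proof. by split=> [|c e]; apply: val_inj. Qed.
HB.instance Definition _ :=
  GRing.isZmodMorphism.Build (endL S) (endL mod_Ann) endL_Ann endL_Ann_zmod.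
HB.instance Definition _ :=
  GRing.isMonoidMorphism.Build (endL S) (endL mod_Ann) endL_Ann endL_Ann_monoid.

(* H^1(L / Ann_L(S), S) as a module over End_L(S). *)
Definition H1_Ann : lmodType (endL S) := restr_scalars endL_Ann (H1 mod_Ann).

End Annihilator.

Section ChiefFactors.
Context {F : fieldType} {L : lieAlgType F}.
Variables I J : ideal L.

(* J/I as a subspace of L/I, for I contained in J *)
Definition factor : {vspace lquot I} := (lpi I @: J)%VS.

Lemma factor_is_ideal : is_ideal factor.
Proof.
move=> q _ /memv_imgP[y Jy ->]; rewrite -[q]lreprK -lpi_lie_hom.
exact/memv_img/idealP.
Qed.

Definition factor_rho : 'Hom(L, 'End(subvs_of factor)) :=
  bilfun (fun x w => vsproj factor (lie (lpi I x) (vsval w))).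

Lemma factor_rhoE x w : vsval (factor_rho x w) = lie (lpi I x) (vsval w).
Proof.
rewrite /factor_rho bilfunE ?vsprojK //.
- exact/factor_is_ideal/subvsP.
- by move=> v a y z; rewrite linearP lieDl lieZl linearP.
- by move=> y a v w'; rewrite /= !linearP.
Qed.

Fact factor_rhoP x y w :
  factor_rho (lie x y) w
  = factor_rho x (factor_rho y w) - factor_rho y (factor_rho x w).
Proof.
by apply: val_inj; rewrite /= !factor_rhoE lpi_lie_hom lie_leibniz.
Qed.

Definition factor_mod : lieModType L := LieMod factor_rhoP.

Definition abelian_factor :=
  forall v w, v \in factor -> w \in factor -> lie v w = 0.

(* The canonical map L/I -> L/J, for I contained in J *)
Definition lquot_map (q : lquot I) : lquot J := lpi J (repr q).

Lemma lquot_mapE x : (I <= J)%VS -> lquot_map (lpi I x) = lpi J x.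
Proof.
by move=> /subvP sIJ; apply/lpi_eqP/sIJ/lpi_eqP/lreprK.
Qed.

(* The sequence 0 -> J/I -> L/I -> L/J -> 0 splits: the projection has a
   section that is a homomorphism of Lie algebras. *)
Definition split_factor :=
  exists2 s : 'Hom(lquot J, lquot I), lie_hom s & cancel s lquot_map.

End ChiefFactors.

Record chiefSeries (F : fieldType) (L : lieAlgType F) := ChiefSeries {
  chief_length : nat;
  chief_ideal :> nat -> ideal L;
  chief_bot : chief_ideal 0%N = 0%VS :> {vspace L};
  chief_top : chief_ideal chief_length = fullv :> {vspace L};
  chief_sub : forall j, (j < chief_length)%N ->
    (chief_ideal j <= chief_ideal j.+1)%VS;
  chief_min : forall j, (j < chief_length)%N ->
    minimal_ideal (factor (chief_ideal j) (chief_ideal j.+1))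
}.

(* [L : S]_split with respect to the chief series [c]; the indices are shifted
   by one, so that [j] stands for the factor L_(j+1) / L_j. *)
Definition split_mult (F : fieldType) (L : lieAlgType F) (c : chiefSeries L)
    (S : lieModType L) : nat :=
  #|[set j : 'I_(chief_length c) |
      `[< [/\ abelian_factor (c j) (c j.+1),
              mod_iso (factor_mod (c j) (c j.+1)) S
            & split_factor (c j) (c j.+1)] >]]|.

(* Main.v *)
Require Import Defs.
From mathcomp Require Import all_boot all_order all_algebra.
From mathcomp Require Import boolp.

(** Let D = End_L(S) and let A be the annihilator of S in L. Inflation
    identifies the 1-cocycles of L/A with the 1-cocycles of L that vanish on A,
    and it identifies the coboundaries of L/A with those of L. Hence
    dim H^1(L,S) - dim H^1(L/A,S) is the codimension, in the space of all
    1-cocycles of L, of those that vanish on A.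

    A chief series filters this difference by the spaces V_j of 1-cocycles that
    vanish on L_j :&: A. The step from V_(j-1) to V_j has dimension 1 over D if
    L_j/L_(j-1) is abelian, isomorphic to S and split, and 0 otherwise
    (dim_cocycles_chief_factor):
    - if V_(j-1) differs from V_j, a cocycle g in the difference maps L_j onto S
      with kernel L_(j-1) (complementing_of_cocycle). It induces the isomorphism
      from L_j/L_(j-1) to S, and its kernel, a subalgebra of L, provides the
      splitting;
    - conversely, the projection of L/L_(j-1) onto an abelian factor
      L_j/L_(j-1) along a complementing subalgebra is such a cocycle
      (complementing_exists);
    - given one such g, every other element of V_(j-1) agrees on L_j with
      c \o g for a unique c in D (complementing_dim).

    All dimensions are counted over the ground field, and divided by dim D only
    at the end: a space with a D-basis of n elements has dimension n * dim D
    over F (has_dim_dim). *)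

Set Implicit Arguments.
Unset Strict Implicit.
Unset Printing Implicit Defensive.

Import GRing.Theory.
Local Open Scope ring_scope.

(** * Dimensions of spaces of linear maps *)

Section LinearAlgebra.
Context {F : fieldType}.
Implicit Types V W : vectType F.

Lemma dim_linear_inj V W (f : V -> W) :
  linear f -> injective f -> (dim V <= dim W)%N.
Proof.
move=> f_lin f_inj; rewrite -!dimvf.
have /lker0P/eqP f0 : injective (linfun f).
  by move=> u v; rewrite !linfun_linearE //; apply: f_inj.
rewrite -(limg_dim_eq (f := linfun f) (U := fullv)) ?f0 ?capv0 //.
exact/dimvS/subvf.
Qed.

Lemma dim_linear_bij V W (f : V -> W) :
  linear f -> bijective f -> dim V = dim W.
Proof.
move=> f_lin f_bij; apply/eqP; rewrite eqn_leq (dim_linear_inj f_lin (bij_inj f_bij)) /=.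
case: f_bij => g fK gK; apply: (dim_linear_inj (f := g)); last exact: can_inj gK.
by move=> a u v; apply: (can_inj fK); rewrite f_lin !gK.
Qed.

Lemma dim_vquot V (U : {vspace V}) : (dim (vquot U) + \dim U = dim V)%N.
Proof.
rewrite -!dimvf -[RHS](limg_ker_dim (linfun (vpi U))) addnC; congr (_ + _)%N.
  congr (\dim _); apply/vspaceP => v; rewrite memv_cap memvf memv_ker lfunE /=.
  rewrite -{1}[v]subr0 -(linear0 (vpi U)).
  by apply/vpi_eqP/eqP.
have -> : (linfun (vpi U) @: fullv)%VS = fullv; last by [].
apply/vspaceP => q; rewrite memvf -[q]vreprK.
by apply/memv_imgP; exists (repr q); rewrite ?memvf // lfunE.
Qed.

(** Written with the projection to U to make it visibly the kernel of a linear
    map. *)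
Definition vanishing V W (U : {vspace V}) : {vspace 'Hom(V, W)} :=
  lker (linfun (fun f : 'Hom(V, W) => (f \o projv U)%VF)).

Lemma vanishingP V W (U : {vspace V}) (f : 'Hom(V, W)) :
  reflect {in U, forall x, f x = 0} (f \in vanishing W U).
Proof.
have lin : linear (fun f : 'Hom(V, W) => (f \o projv U)%VF).
  by move=> a g h; apply/lfunP => x; rewrite !lfun_simp.
rewrite memv_ker linfun_linearE //; apply: (iffP eqP) => [f0 x Ux | f0].
  by have /lfunP/(_ x) := f0; rewrite !lfun_simp /= projv_id.
by apply/lfunP => x; rewrite !lfun_simp /= f0 ?memv_proj.
Qed.

End LinearAlgebra.

(** * Bases over the centralizer algebra *)

Section Centralizer.
Context {F : fieldType} {L : lieAlgType F} {S : lieModType L}.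
Hypothesis irrS : irreducible S.
Local Notation D := (endL S).

(** Schur's lemma: the kernel and the image of an endomorphism are
    submodules. *)
Lemma endL_inverse (c : D) : c != 0 -> exists e : D, e * c = 1.
Proof.
move=> c0; have [_ irr] := irrS.
have ker0 : lker (vsval c) == 0%VS.
  case: (irr (lker (vsval c))) => [x m | -> // | kerf].
    by rewrite !memv_ker endLP => /eqP ->; rewrite linear0.
  case/eqP: c0; apply/val_inj/lfunP => m; rewrite /= lfun_simp.
  by apply/eqP; rewrite -memv_ker kerf memvf.
have eP : (vsval c)^-1%VF \in endL_space S.
  apply/endL_spaceP => x m.
  rewrite -{1}[m](lker0_lfunVK ker0) -endLP lker0_lfunK //.
by exists (Subvs eP); apply/val_inj; rewrite /= lker0_compVf.
Qed.

Lemma dim_endL_gt0 : (0 < dim D)%N.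
Proof.
rewrite lt0n -dimvf dimv_eq0; apply/negP => /eqP D0.
have: (1 : D) \in 0%VS by rewrite -D0 memvf.
rewrite memv0 => /eqP /(congr1 vsval) /= /lfunP one0.
case: irrS => nz _; apply: nz; apply/vspaceP => m.
by rewrite memvf memv0 -[m]id_lfunE one0 lfun_simp eqxx.
Qed.

Section Basis.
(* V and W stand for the same space with its D-module structure and its
   F-space structure; f is the identity in the applications. *)
Variables (V : lmodType D) (W : vectType F) (f : V -> W).
Hypotheses (f_bij : bijective f) (fD : {morph f : u v / u + v}).
Hypothesis fZ : forall (a : F) v, f ((a *: (1 : D)) *: v) = a *: f v.

Let comb n (b : 'I_n -> V) (c : {ffun 'I_n -> D}) : V := \sum_i c i *: b i.

Let combB n (b : 'I_n -> V) c e : comb b (c - e) = comb b c - comb b e.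
Proof.
by rewrite /comb -sumrB; apply: eq_bigr => i _; rewrite !ffunE scalerBl.
Qed.

Let comb_linear n (b : 'I_n -> V) : linear (f \o comb b).
Proof.
move=> a c e; rewrite /= -fZ -fD; congr f.
rewrite /comb scaler_sumr -big_split; apply: eq_bigr => i _ /=.
rewrite !ffunE scalerDl scalerA; congr (_ *: _ + _).
by apply/val_inj/lfunP => m; rewrite /= !lfun_simp.
Qed.

(** Counting dimensions over F turns a D-basis of n elements into the equation
    dim W = n * dim D, so statements about dimensions over D reduce to
    dimension counts over F. *)
Lemma has_dim_dim n : has_dim D V n -> dim W = (n * dim D)%N.
Proof.
move=> [b bP]; rewrite -[n in RHS]card_ord.
have [g gP] := choice bP.
have comb_bij : bijective (comb b).
  exists g => [c|v]; last by have [/esym] := gP v.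
  by have [_ uniq_c] := gP (comb b c); apply: uniq_c.
exact/esym/(dim_linear_bij (comb_linear b))/(bij_comp f_bij comb_bij).
Qed.

(** A D-independent family of maximal length is a basis, because D is a
    division algebra; the length is bounded by the dimension over F. *)
Lemma has_dim_exists : exists n, has_dim D V n.
Proof.
pose P n := exists b : 'I_n -> V, injective (comb b).
have P0 : `[< P 0%N >].
  by apply/asboolP; exists (fun _ => 0) => c e _; apply/ffunP => -[].
have Pmax n : `[< P n >] -> (n <= dim W)%N.
  move=> /asboolP[b b_inj]; rewrite -[n]card_ord.
  apply: leq_trans (dim_linear_inj (comb_linear b) _).
    by rewrite -{1}[#|_|]muln1 leq_mul // dim_endL_gt0.
  exact: inj_comp (bij_inj f_bij) b_inj.
have exP : exists n, `[< P n >] by exists 0%N.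
(* A vector v outside the span of a maximal family b would extend it. *)
case: (ex_maxnP exP Pmax) => n /asboolP[b b_inj] n_max.
exists n, b => v; have [[c vE] | nv] := pselect (exists c, v = comb b c).
  by exists c; split=> // e; rewrite vE => /b_inj.
suff /asboolP/n_max : P n.+1 by rewrite ltnn.
exists (fun i => oapp b v (unlift ord0 i)).
set b' := (b' in comb b').
have b'E c : comb b' c = c ord0 *: v + comb b [ffun i => c (lift ord0 i)].
  rewrite /comb big_ord_recl /b' unlift_none /=; congr (_ + _).
  by apply: eq_bigr => i _; rewrite liftK ffunE.
suff ker0 c : comb b' c = 0 -> c = 0.
  by move=> c e /eqP; rewrite -subr_eq0 -combB => /eqP/ker0/eqP; rewrite subr_eq0 => /eqP.
rewrite b'E; set c' := finfun _ => cE.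
have comb0 : comb b 0 = 0 by rewrite -[0 in LHS](subrr 0) combB subrr.
have c0 : c ord0 = 0.
  have [// | /endL_inverse[e eE]] := eqVneq (c ord0) 0.
  case: nv; exists [ffun i => - e * c' i].
  have -> : v = - (e *: comb b c').
    apply/eqP; rewrite -addr_eq0 -{1}[v]scale1r -eE -scalerA -scalerDr cE.
    by rewrite scaler0.
  rewrite /comb scaler_sumr -sumrN; apply: eq_bigr => i _.
  by rewrite !ffunE mulNr scaleNr scalerA.
move: cE; rewrite c0 scale0r add0r -comb0 => /b_inj c'0.
apply/ffunP => i; case: (unliftP ord0 i) => [j|] ->; rewrite ?c0 ?ffunE //.
by move/ffunP/(_ j): c'0; rewrite !ffunE.
Qed.

End Basis.
End Centralizer.

(** * A chief factor complemented by the kernel of a cocycle *)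

Section ChiefFactor.
Context {F : fieldType} {L : lieAlgType F} {S : lieModType L}.
Variables I J : ideal L.
Hypothesis sIJ : (I <= J)%VS.
Implicit Types (x y : L) (s : S) (g h : 'Hom(L, S)).
Local Notation A := (Ann_space S).

Lemma Z1P g :
  reflect (forall x y, g (lie x y) = rho x (g y) - rho y (g x)) (g \in Z1 S).
Proof.
rewrite memv_ker; apply: (iffP eqP) => [g0 x y | gP].
  have /lfunP/(_ x)/lfunP/(_ y) := g0; rewrite ce_d1E !lfun_simp => /eqP.
  by rewrite subr_eq0 => /eqP.
by apply/lfunP => x; apply/lfunP => y; rewrite ce_d1E gP subrr !lfun_simp.
Qed.

Lemma Z1_Ann g x y : g \in Z1 S -> y \in A -> g (lie x y) = rho x (g y).
Proof. by move=> /Z1P gP /Ann_spaceP Ay; rewrite gP Ay subr0. Qed.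

Lemma lpi_eq0 x : (lpi I x == 0) = (x \in I).
Proof. by rewrite -{2}[x]subr0 -(linear0 (lpi I)); apply/eqP/lpi_eqP. Qed.

Lemma mem_factor x : (lpi I x \in factor I J) = (x \in J).
Proof.
apply/idP/idP => [/memv_imgP[y Jy /lpi_eqP xy] | Jx]; last exact: memv_img.
by rewrite -[x](subrK y) memvD // (subvP sIJ).
Qed.

Lemma factor_repr (w : subvs_of (factor I J)) :
  exists2 y, y \in J & vsval w = lpi I y.
Proof. exact/memv_imgP/subvsP. Qed.

Lemma minimal_factor_cover (W : {vspace L}) :
    minimal_ideal (factor I J) -> is_ideal W -> (W <= J)%VS -> ~~ (W <= I)%VS ->
  {in J, forall y, exists2 w, w \in W & y - w \in I}.
Proof.
move=> [_ _ minJ] idW sWJ /subvPn[w Ww nIw] y Jy.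
have E : factor I (Ideal idW) = factor I J.
  apply: minJ _ (limgS _ sWJ) _; first exact: (@factor_is_ideal _ _ I (Ideal idW)).
  move=> W0; have : lpi I w \in factor I (Ideal idW) by apply: memv_img.
  by rewrite /factor W0 memv0 lpi_eq0 (negPf nIw).
have : lpi I y \in factor I (Ideal idW) by rewrite E mem_factor.
by move=> /memv_imgP[v Wv /lpi_eqP yv]; exists v.
Qed.

(** Such a g maps J onto S with kernel I, so it induces an isomorphism from J/I
    to S, and its kernel, a subalgebra of L, is a complement to J modulo I.
    All three conditions in the count of split chief factors are thus contained
    in the existence of one cocycle. *)
Definition complementing g :=
  [/\ g \in Z1 S, (J <= A)%VS, forall s, exists2 x, x \in J & g x = s
    & {in J, forall x, (g x == 0) = (x \in I)}].

(** Irreducibility of S and minimality of J/I force everything: g maps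
    J :&: Ann(S) onto a nonzero submodule of S. As J = (J :&: Ann(S)) + I, it
    remains to see that I annihilates S, and this holds because
    x . g(a) = g [x, a] and [x, a] lies in I :&: Ann(S) for x in I. *)
Lemma complementing_of_cocycle g a0 :
    irreducible S -> minimal_ideal (factor I J) -> g \in Z1 S ->
    {in (I :&: A)%VS, forall x, g x = 0} -> a0 \in (J :&: A)%VS -> g a0 != 0 ->
  complementing g.
Proof.
move=> [_ irr] minJ Zg gIA JAa0 ga0; pose B := (J :&: A)%VS.
have idA := @Ann_is_ideal _ _ S.
have BP x : x \in B -> x \in J /\ x \in A by rewrite memv_cap => /andP.
have idB : is_ideal B.
  by move=> x y /BP[Jy Ay]; rewrite memv_cap (idealP (i := J)) //= idA.
have sBJ : (B <= J)%VS by apply: capvSl.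
have gB : (g @: B)%VS = fullv.
  case: (irr (g @: B)%VS) => [x _ /memv_imgP[y By ->] | g0 | //].
    by have [_ Ay] := BP _ By; rewrite -Z1_Ann // memv_img // idB.
  by move: ga0; rewrite -memv0 -g0 memv_img.
have g_onto s : exists2 a, a \in B & g a = s.
  by have /memv_imgP[a Ba ->] : s \in (g @: B)%VS; [rewrite gB memvf | exists a].
have sIA : (I <= A)%VS.
  apply/subvP => x Ix; apply/Ann_spaceP => s; have [a Ba <-] := g_onto s.
  have [_ Aa] := BP _ Ba; rewrite -Z1_Ann // gIA // memv_cap idA // andbT.
  by rewrite lie_anti memvN idealP.
have gI x : x \in I -> g x = 0.
  by move=> Ix; apply: gIA; rewrite memv_cap Ix (subvP sIA).
have nBI : ~~ (B <= I)%VS.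
  by apply/subvPn; exists a0 => //; apply: contra_neqN ga0 => /gI.
have sJA : (J <= A)%VS.
  apply/subvP => y Jy.
  have [a /BP[_ Aa] Iya] := minimal_factor_cover minJ idB sBJ nBI Jy.
  by rewrite -[y](subrK a) memvD // (subvP sIA).
split=> // [s | x Jx]; first by have [a /BP[Ja _]] := g_onto s; exists a.
apply/eqP/idP => [gx0 | /gI //]; apply: contraNT ga0 => nIx.
(* The kernel of g on J is an ideal of L; were it not contained in I, it
   would cover J/I, and g would vanish on J. *)
pose K := (J :&: lker g)%VS.
have KP y : y \in K -> y \in J /\ g y = 0.
  by rewrite memv_cap memv_ker => /andP[? /eqP].
have idK : is_ideal K.
  move=> z y /KP[Jy gy]; rewrite memv_cap memv_ker (idealP (i := J)) //=.
  by rewrite Z1_Ann ?gy ?linear0 // (subvP sJA).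
have nKI : ~~ (K <= I)%VS.
  by apply/subvPn; exists x => //; rewrite memv_cap Jx memv_ker gx0 eqxx.
have [Ja0 _] := BP _ JAa0.
have [k /KP[_ gk] /gI] := minimal_factor_cover minJ idK (capvSl _ _) nKI Ja0.
by rewrite linearB /= gk subr0 => ->.
Qed.

Section Complementing.
Variable g : 'Hom(L, S).
Hypothesis gC : complementing g.

Lemma complementing_ker x : x \in I -> g x = 0.
Proof.
move=> Ix; have [_ _ _ gJ] := gC; apply/eqP.
by rewrite gJ // (subvP sIJ).
Qed.

Lemma complementing_abelian : abelian_factor I J.
Proof.
have [Zg /subvP sJA _ gJ] := gC.
move=> _ _ /memv_imgP[x Jx ->] /memv_imgP[y Jy ->].
rewrite -lpi_lie_hom; apply/eqP; rewrite lpi_eq0 -gJ ?idealP //.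
have /Ann_spaceP Ax := sJA x Jx.
by rewrite Z1_Ann ?sJA // Ax.
Qed.

Lemma complementing_iso : mod_iso (factor_mod I J) S.
Proof.
have [Zg /subvP sJA g_onto gJ] := gC.
pose f (w : subvs_of (factor I J)) : S := g (repr (vsval w)).
have fE w x : vsval w = lpi I x -> f w = g x.
  move=> wE; apply/eqP; rewrite -subr_eq0 -linearB; apply/eqP.
  by apply/complementing_ker/lpi_eqP; rewrite lreprK.
have f_lin : linear f.
  move=> a u v; have [x Jx ux] := factor_repr u; have [y Jy vy] := factor_repr v.
  rewrite (fE _ _ ux) (fE _ _ vy) -linearP; apply: fE.
  by rewrite linearP /= ux vy linearP.
have fL := linfun_linearE f_lin.
have f_inj : injective f.
  move=> u v /eqP; rewrite -subr_eq0.
  have [x Jx ux] := factor_repr u; have [y Jy vy] := factor_repr v.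
  rewrite (fE _ _ ux) (fE _ _ vy) -linearB gJ; last exact: memvB.
  move=> /lpi_eqP xy.
  by apply: val_inj; rewrite /= ux vy.
exists (linfun f) => [|x w].
  have inv s : exists w, f w = s.
    have [x Jx <-] := g_onto s.
    have Fx : lpi I x \in factor I J by rewrite mem_factor.
    by exists (Subvs Fx); apply: fE.
  have [k kP] := choice inv.
  exists k => [w|s]; rewrite fL ?kP //.
  by apply: f_inj; rewrite kP.
have [y Jy wy] := factor_repr w.
rewrite !fL (fE _ _ wy) -Z1_Ann ?sJA //; apply: fE.
by rewrite factor_rhoE wy lpi_lie_hom.
Qed.

Lemma complementing_split : split_factor I J.
Proof.
have [Zg /subvP sJA g_onto gJ] := gC.
have /choice[r rP] x : exists y, y \in J /\ g y = g x.
  by have [y Jy gy] := g_onto (g x); exists y.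
(* k q is the representative of q modulo J in the kernel of g; it is unique
   modulo I. *)
pose k (q : lquot J) : L := repr q - r (repr q).
pose s q : lquot I := lpi I (k q).
have gk q : g (k q) = 0.
  by have [_ gr] := rP (repr q); rewrite /k linearB /= gr subrr.
have kK q : lpi J (k q) = q.
  rewrite -[RHS]lreprK; apply/lpi_eqP; have [Jr _] := rP (repr q).
  by rewrite addrAC subrr add0r memvN.
have sE x : g x = 0 -> s (lpi J x) = lpi I x.
  move=> gx; apply/lpi_eqP; rewrite -gJ; last exact/lpi_eqP/kK.
  by rewrite linearB /= gk gx subrr.
have s_lin : linear s.
  move=> a p q; rewrite -{1}[p]kK -{1}[q]kK -linearP sE ?linearP //.
  by rewrite /= !gk scaler0 addr0.
exists (linfun s) => [p q | q]; rewrite !linfun_linearE //.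
  rewrite -{1}[p]kK -{1}[q]kK -lpi_lie_hom sE ?lpi_lie_hom //.
  by move/Z1P: Zg => ->; rewrite !gk !linear0 addr0.
by rewrite lquot_mapE // kK.
Qed.

(** Restricting a cocycle that vanishes on I to J gives a module homomorphism
    from J/I to S. Composing it with the inverse of the isomorphism induced by g
    gives an endomorphism c of S, and the given cocycle agrees with c \o g
    on J. *)
Lemma complementing_dim :
  \dim (Z1 S :&: vanishing S I) = (dim (endL S) + \dim (Z1 S :&: vanishing S J))%N.
Proof.
have [Zg /subvP sJA g_onto gJ] := gC.
pose act (c : endL S) : 'Hom(L, S) := (vsval c \o g)%VF.
have act_lin : linear act.
  by move=> a c e; apply/lfunP => x; rewrite !lfun_simp.
pose E := limg (linfun act).
have dimE : \dim E = dim (endL S).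
  rewrite limg_dim_eq ?dimvf // capfv; apply/eqP/lker0P => c e.
  rewrite !linfun_linearE // => ce; apply/val_inj/lfunP => s.
  have [x _ <-] := g_onto s.
  by have /lfunP/(_ x) := ce; rewrite !lfun_simp.
have actV c : act c \in (Z1 S :&: vanishing S I)%VS.
  rewrite memv_cap; apply/andP; split; last first.
    by apply/vanishingP => x Ix; rewrite lfun_simp /= complementing_ker ?linear0.
  by apply/Z1P => x y; rewrite !lfun_simp /= -!endLP -linearB; move/Z1P: Zg => ->.
rewrite -dimE -dimv_disjoint_sum.
  congr (\dim _); apply/vspaceP => h; apply/idP/idP; last first.
    move=> /memv_addP[_ /memv_imgP[c _ ->] [h' Vh' ->]].
    rewrite memvD ?linfun_linearE //; apply: (subvP _ _ Vh').
    apply: capvS => //; apply/subvP => f /vanishingP fJ.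
    by apply/vanishingP => x Ix; apply/fJ/(subvP sIJ).
  rewrite memv_cap => /andP[Zh /vanishingP hI].
  have /choice[r rP] s : exists y, y \in J /\ g y = s.
    by have [y Jy gy] := g_onto s; exists y.
  pose c s := h (r s).
  have cE y : y \in J -> c (g y) = h y.
    move=> Jy; have [Jr gr] := rP (g y); apply/eqP.
    rewrite -subr_eq0 -linearB /= hI // -gJ ?memvB //.
    by rewrite linearB /= gr subrr.
  have c_lin : linear c.
    move=> a s t; have [Js gs] := rP s; have [Jt gt] := rP t.
    rewrite -{1}gs -{1}gt -linearP cE ?linearP //.
    by rewrite memvD ?memvZ.
  have cL := linfun_linearE c_lin.
  have cD : linfun c \in endL_space S.
    apply/endL_spaceP => x s; have [Js gs] := rP s.
    rewrite !cL -gs -Z1_Ann ?sJA // !cE ?idealP //.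
    by rewrite Z1_Ann ?sJA.
  rewrite -[h](subrKC (act (Subvs cD))) memv_add //.
    by rewrite -(linfun_linearE act_lin) memv_img ?memvf.
  rewrite memv_cap; apply/andP; split.
    by rewrite memvB //; have := actV (Subvs cD); rewrite memv_cap => /andP[].
  by apply/vanishingP => x Jx; rewrite !lfun_simp /= cL cE // subrr.
apply/eqP; rewrite -subv0; apply/subvP => _ /memv_capP[/memv_imgP[c _ ->]].
rewrite linfun_linearE // memv_cap => /andP[_ /vanishingP c0].
rewrite memv0; apply/eqP/lfunP => x; have [y Jy gy] := g_onto (g x).
by rewrite !lfun_simp /= -gy; have := c0 y Jy; rewrite lfun_simp.
Qed.

End Complementing.

(** The projection of L/I onto J/I along a complementing subalgebra is a
    cocycle, because J/I is abelian. *)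
Lemma complementing_exists :
  abelian_factor I J -> mod_iso (factor_mod I J) S -> split_factor I J ->
  exists g, complementing g.
Proof.
move=> abJ [f f_bij fP] [s s_hom sK].
pose p x : lquot I := lpi I x - s (lpi J x).
have p_fac x : p x \in factor I J.
  rewrite /p -[s _]lreprK -linearB mem_factor; apply/lpi_eqP.
  by rewrite -[LHS]sK -{1}[s _]lreprK lquot_mapE.
pose g := (f \o (linfun (vsproj (factor I J)) \o (lpi I - (s \o lpi J))))%VF.
have gE x w : vsval w = p x -> g x = f w.
  move=> wE; rewrite /g !comp_lfunE.
  have -> : (lpi I - (s \o lpi J))%VF x = p x by rewrite /p !lfun_simp.
  rewrite lfunE /=; congr (f _); apply: val_inj.
  by apply: etrans (esym wE); apply: vsprojK; apply: p_fac.
have pJ x : x \in J -> p x = lpi I x.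
  move=> Jx; rewrite /p; have -> : lpi J x = 0; last by rewrite linear0 subr0.
  by rewrite -(linear0 (lpi J)); apply/lpi_eqP; rewrite subr0.
have sJA : (J <= A)%VS.
  apply/subvP => x Jx; apply/Ann_spaceP => m; case: f_bij => f' fK f'K.
  rewrite -[m]f'K -fP (_ : rho x _ = 0) ?linear0 //; apply: val_inj.
  by apply: etrans (factor_rhoE _ _) _; rewrite abJ ?mem_factor ?subvsP.
exists g; split=> // [|m|x Jx].
- apply/Z1P => x y.
  pose wx := Subvs (p_fac x); pose wy := Subvs (p_fac y).
  rewrite (gE x wx) // (gE y wy) // -!fP -linearB; apply: gE.
  rewrite [LHS]linearB [X in X - _]factor_rhoE [X in _ - X]factor_rhoE.
  set X := lpi I x; set Y := lpi I y.
  have -> : p (lie x y) = lie X Y - lie (s (lpi J x)) (s (lpi J y)).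
    by rewrite -s_hom -!lpi_lie_hom.
  rewrite -[vsval wx]/(p x) -[vsval wy]/(p y).
  have -> : s (lpi J x) = X - p x by rewrite opprB addrC subrK.
  have -> : s (lpi J y) = Y - p y by rewrite opprB addrC subrK.
  have lieBl (P Q R : lquot I) : lie (P - Q) R = lie P R - lie Q R.
    by rewrite lieDl -scaleN1r lieZl scaleN1r.
  have lieBr (P Q R : lquot I) : lie R (P - Q) = lie R P - lie R Q.
    exact: linearB.
  (* Only bilinearity and [P, Q] = 0 for P = p x and Q = p y remain. *)
  move: (p x) (p y) (abJ _ _ (p_fac x) (p_fac y)) => P Q PQ.
  rewrite !lieBr !lieBl PQ subr0 [lie Y P]lie_anti.
  by rewrite !opprD !opprK -!addrA addNKr addrC.
- case: f_bij => f' fK f'K; have [x Jx wx] := factor_repr (f' m).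
  by exists x => //; rewrite (gE x (f' m)) ?f'K // pJ.
- have [f' fK _] := f_bij; rewrite (gE x (Subvs (p_fac x))) //.
  rewrite -(linear0 f) (inj_eq (can_inj fK)) -(inj_eq val_inj) /= pJ //.
  exact: lpi_eq0.
Qed.

(** A cocycle in the larger space but not in the smaller one is complementing,
    hence the two spaces coincide unless J/I is a split chief factor isomorphic
    to S. If it is one, then J annihilates S, the intersections are I and J
    themselves, and complementing_dim applies. *)
Lemma dim_cocycles_chief_factor :
  irreducible S -> minimal_ideal (factor I J) ->
  \dim (Z1 S :&: vanishing S (I :&: A)) =
  (`[< [/\ abelian_factor I J, mod_iso (factor_mod I J) S
        & split_factor I J] >] * dim (endL S)
   + \dim (Z1 S :&: vanishing S (J :&: A)))%N.
Proof.
move=> irrS minJ; case: asboolP => [[abJ isoJ splitJ] | nsplit] /=.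
  have [g gC] := complementing_exists abJ isoJ splitJ.
  have [_ sJA _ _] := gC.
  rewrite mul1n (capv_idPl sJA) (capv_idPl (subv_trans sIJ sJA)).
  exact: complementing_dim gC.
congr (\dim _); apply/vspaceP => g; rewrite !memv_cap.
case Zg: (g \in Z1 S) => //=; apply/vanishingP/vanishingP => g0 x; last first.
  by move=> IAx; apply: g0; apply: subvP IAx; apply: capvS.
move=> JAx; apply/eqP; apply: contraPT isT => gx; case: nsplit.
have gC := complementing_of_cocycle irrS minJ Zg g0 JAx gx.
split; [exact: complementing_abelian gC | exact: complementing_iso gC |].
exact: complementing_split gC.
Qed.

End ChiefFactor.

(** * First cohomology and inflation from L / Ann(S) *)

Section FirstCohomology.
Context {F : fieldType} {L : lieAlgType F} (M : lieModType L).

(** The quotient that underlies H1 M is a vector space over F; the D-module H1 M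
    keeps only its additive group. *)
Definition H1F : vectType F := vquot (linfun (@vsval _ _ (Z1 M)) @^-1: B1 M)%VS.

Lemma dim_H1F : (dim H1F + \dim (B1 M) = \dim (Z1 M))%N.
Proof.
have -> : \dim (Z1 M) = dim (subvs_of (Z1 M)) by [].
rewrite -(dim_vquot (linfun (@vsval _ _ (Z1 M)) @^-1: B1 M)%VS).
congr (_ + _)%N; rewrite -[B1 M in LHS](@lpreimK _ _ _ (linfun (@vsval _ _ (Z1 M)))).
  rewrite limg_dim_eq //; apply/eqP; rewrite -subv0; apply/subvP => z.
  by rewrite memv_cap memv_ker lfunE memv0 => /andP[_].
apply/subvP => b /(subvP (B1_sub_Z1 M)) Zb; apply/memv_imgP.
by exists (Subvs Zb); rewrite ?memvf // lfunE.
Qed.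

Lemma H1_scaleF (a : F) (h : H1 M) : (a *: (1 : endL M)) *: h = a *: (h : H1F).
Proof.
rewrite -[h]H1_reprK [LHS]H1_scaleE [RHS]vqscaleE; congr H1_class.
by apply/val_inj/lfunP => x; rewrite /= !lfun_simp.
Qed.

End FirstCohomology.

Section Inflation.
Context {F : fieldType} {L : lieAlgType F} (S : lieModType L).
Local Notation Q := (lquot (Ann S)).
Local Notation SA := (mod_Ann S).

Let infl (f : 'Hom(Q, S)) : 'Hom(L, S) := (f \o lpi (Ann S))%VF.

Let infl_linear : linear infl.
Proof. by move=> a f g; apply/lfunP => x; rewrite !lfun_simp. Qed.

Let infl_inj : injective infl.
Proof.
move=> f g fg; apply/lfunP => q; rewrite -[q]lreprK.
by have /lfunP/(_ (repr q)) := fg; rewrite !comp_lfunE.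
Qed.

Let dim_infl (U : {vspace 'Hom(Q, S)}) : \dim (linfun infl @: U) = \dim U.
Proof.
apply: limg_dim_eq; have /lker0P/eqP -> : injective (linfun infl).
  by move=> f g; rewrite !linfun_linearE //; apply: infl_inj.
by rewrite capv0.
Qed.

Lemma dim_Z1_Ann :
  \dim (Z1 SA) = \dim (Z1 S :&: vanishing S (Ann_space S)).
Proof.
rewrite -dim_infl; congr (\dim _); apply/vspaceP => f; apply/memv_imgP/idP.
  move=> [g /(@Z1P _ _ SA g) Zg ->]; rewrite linfun_linearE // memv_cap; apply/andP; split.
    by apply/Z1P => x y; rewrite !comp_lfunE lpi_lie_hom Zg /= !rho_AnnE.
  apply/vanishingP => x Ax; rewrite comp_lfunE.
  rewrite (_ : lpi (Ann S) x = 0) ?linear0 //.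
  by apply/eqP; rewrite lpi_eq0.
rewrite memv_cap => /andP[/Z1P Zf /vanishingP fA].
pose g (q : Q) : S := f (repr q).
have gE x : g (lpi (Ann S) x) = f x.
  apply/eqP; rewrite /g -subr_eq0 -linearB /= fA //.
  exact/(@lpi_eqP _ _ (Ann S))/lreprK.
have g_lin : linear g.
  by move=> a p q; rewrite -{1}[p]lreprK -{1}[q]lreprK -linearP gE linearP.
have gL := linfun_linearE g_lin.
exists (linfun g).
  apply/(@Z1P _ _ SA) => p q; rewrite -[p]lreprK -[q]lreprK -lpi_lie_hom.
  by rewrite !gL !gE Zf /= !rho_AnnE.
by rewrite linfun_linearE //; apply/lfunP => x; rewrite comp_lfunE gL gE.
Qed.

Lemma dim_B1_Ann : \dim (B1 SA) = \dim (B1 S).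
Proof.
rewrite -dim_infl; congr (\dim _).
rewrite /B1 -limg_comp; congr (limg _); apply/lfunP => s.
apply/lfunP => x; rewrite comp_lfunE (linfun_linearE infl_linear) comp_lfunE.
rewrite ce_d0E; apply: etrans (@ce_d0E _ _ SA s _) _.
by rewrite /= rho_AnnE.
Qed.

End Inflation.

(** * The multiplicity of S as a split chief factor *)

(** Telescoping: the spaces of cocycles vanishing on L_j :&: Ann(S) decrease
    from all cocycles of L to the cocycles inflated from L / Ann(S). *)
Lemma dim_Z1_split_mult (F : fieldType) (L : lieAlgType F) (S : lieModType L)
    (c : chiefSeries L) :
  irreducible S ->
  \dim (Z1 S) = (split_mult c S * dim (endL S) + \dim (Z1 (mod_Ann S)))%N.
Proof.
move=> irrS; rewrite dim_Z1_Ann.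
pose v j := \dim (Z1 S :&: vanishing S (c j :&: Ann_space S)).
pose b j := `[< [/\ abelian_factor (c j) (c j.+1),
  mod_iso (factor_mod (c j) (c j.+1)) S & split_factor (c j) (c j.+1)] >].
have -> : \dim (Z1 S) = v 0%N.
  rewrite /v chief_bot cap0v; congr (\dim _); apply/esym/capv_idPl/subvP => f _.
  by apply/vanishingP => x; rewrite memv0 => /eqP ->; rewrite linear0.
have -> : \dim (Z1 S :&: vanishing S (Ann_space S)) = v (chief_length c).
  by rewrite /v chief_top capfv.
have -> : split_mult c S = (\sum_(j < chief_length c) b j)%N.
  rewrite /split_mult -sum1_card big_mkcond; apply: eq_bigr => j _.
  by rewrite inE -/(b j); case: (b j).
have step j : (j < chief_length c)%N -> v j = (b j * dim (endL S) + v j.+1)%N.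
  move=> lt_j; apply: dim_cocycles_chief_factor => //; first exact: chief_sub.
  exact: chief_min.
elim: (chief_length c) step => [|n IHn] step; first by rewrite big_ord0.
rewrite big_ord_recr /= mulnDl -addnA -step // IHn // => j lt_jn.
exact/step/ltnW.
Qed.

Theorem theorem2p1 (F : fieldType) (L : lieAlgType F) (S : lieModType L)
    (irrS : irreducible S) :
  [/\ exists d : nat, has_dim (endL S) (H1 S) d,
      exists d' : nat, has_dim (endL S) (H1_Ann S) d',
      forall (c : chiefSeries L) (d d' : nat),
        has_dim (endL S) (H1 S) d -> has_dim (endL S) (H1_Ann S) d' ->
        (split_mult c S)%:Z = d%:Z - d'%:Z
    & forall c c' : chiefSeries L, split_mult c S = split_mult c' S].
Proof.
have idK (T : Type) : bijective (fun x : T => x) by exists id.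
have scaleS : forall (a : F) (h : H1 S),
  (a *: (1 : endL S)) *: h = a *: (h : H1F S) by exact: H1_scaleF.
have scaleA : forall (a : F) (h : H1_Ann S),
    (a *: (1 : endL S)) *: h = a *: (h : H1F (mod_Ann S)).
  move=> a h; rewrite -H1_scaleF; apply: (congr1 (fun e => H1_scale e h)).
  exact: val_inj.
have [d dP] : exists d, has_dim (endL S) (H1 S) d.
  exact: (has_dim_exists irrS (f := id : H1 S -> H1F S)).
have [d' d'P] : exists d', has_dim (endL S) (H1_Ann S) d'.
  exact: (has_dim_exists irrS (f := id : H1_Ann S -> H1F (mod_Ann S))).
have count (c : chiefSeries L) e e' :
    has_dim (endL S) (H1 S) e -> has_dim (endL S) (H1_Ann S) e' ->
    e = (split_mult c S + e')%N.
  move=> eP e'P; apply/eqP; rewrite -(eqn_pmul2r (dim_endL_gt0 irrS)) mulnDl.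
  rewrite -(has_dim_dim (f := id : H1 S -> H1F S) _ _ _ eP) //.
  rewrite -(has_dim_dim (f := id : H1_Ann S -> H1F (mod_Ann S)) _ _ _ e'P) //.
  rewrite -(eqn_add2r (\dim (B1 S))) -addnA dim_H1F -dim_B1_Ann dim_H1F.
  by rewrite -dim_Z1_split_mult.
split; [by exists d | by exists d' | |] => [c e e' eP e'P | c c'].
  by rewrite (count c e e') // PoszD addrK.
by apply/eqP; rewrite -(eqn_add2r d') -!(count _ _ _ dP d'P).
Qed.
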